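(* Let $K$ be a field, let $T^*_K$ be any one of $T_K$, $T_K^s$, $T_K^a$, and let $V$ be an $\mathcal L_K$-structure. The following are equivalent: (i) $V$ is an e.c. model of $T^*_K$; (ii) $V$ is a finitely injective $K$-bilinear space; (iii) $V$ is an infinite dimensional non-degenerate finitely injective $K$-bilinear space. If the theory $T^*_K$ in (i) is $T_K^s$ (respectively $T_K^a$), then the conditions in (ii) and (iii) are further restricted to symmetric (respectively alternating) $K$-bilinear spaces.
   Context: A $K$-bilinear space is a $K$-vector space $V$ with a map $[\cdot,\cdot]:V\times V\to K$ linear in each argument; it is symmetric if $[x,y]=[y,x]$ for all $x,y$, and alternating if $[x,x]=0$ for all $x$. It is non-degenerate if $[x,y]=0$ for all $y$ implies $x=0$, and $[x,y]=0$ for all $x$ implies $y=0$. A bilinear monomorphism is an injective linear map preserving the bilinear form. A $K$-bilinear space $V$ is finitely injective if for any finite dimensional $K$-bilinear spaces $A\subseteq B$ and any bilinear monomorphism $f:A\to V$ there is a bilinear monomorphism $g:B\to V$ extending $f$. In the symmetric/alternating case all the spaces involved are required to be symmetric/alternating. Positive logic: a (positive existential) formula is built from atomic formulas using $\wedge,\vee,\top,\bot,\exists$. An h-inductive sentence has the form $\forall\bar x(\varphi(\bar x)\to\psi(\bar x))$ with $\varphi,\psi$ such formulas; a (positive) theory is a set of h-inductive sentences. A homomorphism is a function between structures preserving truth of formulas; it is an immersion if it also reflects truth of formulas. A model $M$ of $T$ is existentially closed (e.c.) if every homomorphism $f:M\to N$ with $N\models T$ is an immersion. $\mathcal L_K$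 is the standard signature of $K$-vector spaces, with a unary function symbol for multiplication by each $\lambda\in K$, a relation symbol $\neq$ for inequality, and for every $\lambda\in K$ a binary relation symbol written $[x,y]=\lambda$, expressing that the bilinear product of $x$ and $y$ is $\lambda$. Every $K$-bilinear space is naturally viewed as an $\mathcal L_K$-structure. $T_K$, $T_K^s$, $T_K^a$ are the sets of all h-inductive $\mathcal L_K$-sentences true in all $K$-bilinear spaces, all symmetric $K$-bilinear spaces, and all alternating $K$-bilinear spaces, respectively. *)

(* Defs.v *)
From HB Require Import structures.
From mathcomp Require Import all_boot all_order all_algebra.

Set Implicit Arguments.
Unset Strict Implicit.
Unset Printing Implicit Defensive.

Import GRing.Theory.
Local Open Scope ring_scope.

(** * Positive logic *)

Record signature := Signature {
  fsym : Type;
  fsym_arity : fsym -> nat;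
  rsym : Type;
  rsym_arity : rsym -> nat }.

Record fo_structure (L : signature) := FoStructure {
  dom :> Type;
  fun_interp : forall s : fsym L, ('I_(fsym_arity s) -> dom) -> dom;
  rel_interp : forall r : rsym L, ('I_(rsym_arity r) -> dom) -> Prop }.

(* Terms and formulas are well scoped: [term L n] and [formula L n] have their
   free variables among [n] variables indexed by ['I_n]. *)
Inductive term (L : signature) (n : nat) : Type :=
| Var of 'I_n
| App (s : fsym L) of ('I_(fsym_arity s) -> term L n).

(* [Ex] binds the variable [ord0]; the old variable [i] becomes [lift ord0 i].
   Equality is part of the logic, interpreted as true equality. *)
Inductive formula (L : signature) : nat -> Type :=
| Top n : formula L n
| Bot n : formula L n
| Eq n : term L n -> term L n -> formula L n
| Rel n (r : rsym L) : ('I_(rsym_arity r) -> term L n) -> formula L n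
| And n : formula L n -> formula L n -> formula L n
| Or n : formula L n -> formula L n -> formula L n
| Ex n : formula L n.+1 -> formula L n.

Section Semantics.
Variables (L : signature) (M : fo_structure L).

Fixpoint eval n (a : 'I_n -> M) (t : term L n) : M :=
  match t with
  | Var i => a i
  | App s ts => fun_interp (fun i => eval a (ts i))
  end.

Definition extend n (x : M) (a : 'I_n -> M) : 'I_n.+1 -> M :=
  fun i => if unlift ord0 i is Some j then a j else x.

Fixpoint sat n (p : formula L n) : ('I_n -> M) -> Prop :=
  match p with
  | Top _ => fun _ => True
  | Bot _ => fun _ => False
  | Eq _ t u => fun a => eval a t = eval a u
  | Rel _ r ts => fun a => rel_interp (fun i => eval a (ts i))
  | And _ p q => fun a => sat p a /\ sat q a
  | Or _ p q => fun a => sat p a \/ sat q a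
  | Ex _ p => fun a => exists x, sat p (extend x a)
  end.

End Semantics.

(* The sentence [forall x_0 ... x_(n-1), premise -> conclusion]. *)
Record h_inductive (L : signature) := HInductive {
  h_vars : nat;
  h_premise : formula L h_vars;
  h_conclusion : formula L h_vars }.

Definition holds L (M : fo_structure L) (s : h_inductive L) : Prop :=
  forall a : 'I_(h_vars s) -> M, sat (h_premise s) a -> sat (h_conclusion s) a.

Definition theory (L : signature) := h_inductive L -> Prop.

Definition model L (T : theory L) (M : fo_structure L) : Prop :=
  forall s, T s -> holds M s.

Definition homomorphism L (M N : fo_structure L) (f : M -> N) : Prop :=
  forall n (p : formula L n) (a : 'I_n -> M), sat p a -> sat p (f \o a).

Definition immersion L (M N : fo_structure L) (f : M -> N) : Prop :=
  homomorphism f /\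
  forall n (p : formula L n) (a : 'I_n -> M), sat p (f \o a) -> sat p a.

Definition ec_model L (T : theory L) (M : fo_structure L) : Prop :=
  model T M /\
  forall (N : fo_structure L) (f : M -> N),
    model T N -> homomorphism f -> immersion f.

(** * Bilinear spaces *)

Record bilin_space (K : fieldType) := BilinSpace {
  bs_space :> lmodType K;
  bs_form : {bilinear bs_space -> bs_space -> K | *%R & *%R} }.

Arguments BilinSpace {K} bs_space bs_form.

Variant bilin_class := AllForms | SymmetricForms | AlternatingForms.

Definition in_class (K : fieldType) (c : bilin_class) (V : bilin_space K) :
    Prop :=
  match c with
  | AllForms => True
  | SymmetricForms => forall x y : V, bs_form V x y = bs_form V y x
  | AlternatingForms => forall x : V, bs_form V x x = 0
  end.

Definition nondegenerate_space (K : fieldType) (V : bilin_space K) : Prop :=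
  (forall x : V, (forall y : V, bs_form V x y = 0) -> x = 0) /\
  (forall y : V, (forall x : V, bs_form V x y = 0) -> y = 0).

(* The forms are plain functions, so that they can also be restrictions of a
   form to a subspace. *)
Definition bilin_mono (K : fieldType) (U V : lmodType K)
    (bU : U -> U -> K) (bV : V -> V -> K) (f : {linear U -> V}) : Prop :=
  injective f /\ forall x y : U, bV (f x) (f y) = bU x y.

Definition finitely_injective (K : fieldType) (c : bilin_class)
    (V : bilin_space K) : Prop :=
  forall (B : vectType K) (b : {bilinear B -> B -> K | *%R & *%R}),
    in_class c (BilinSpace B b) ->
  forall (A : {vspace B}) (f : {linear subvs_of A -> V}),
    bilin_mono (fun x y => b (vsval x) (vsval y)) (bs_form V) f ->
  exists g : {linear B -> V},
    bilin_mono b (bs_form V) g /\ forall x : subvs_of A, g (vsval x) = f x.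

Definition infinite_dimensional (K : fieldType) (V : lmodType K) : Prop :=
  forall n : nat, Vector.axiom n V -> False.

(** * The signature of bilinear spaces and the theories *)

Variant lk_fsym (K : fieldType) := LkZero | LkAdd | LkOpp | LkScale of K.

Variant lk_rsym (K : fieldType) := LkNeq | LkForm of K.

Arguments LkZero {K}.
Arguments LkAdd {K}.
Arguments LkOpp {K}.
Arguments LkNeq {K}.

Definition lk_fsym_arity (K : fieldType) (s : lk_fsym K) : nat :=
  match s with LkZero => 0 | LkAdd => 2 | LkOpp => 1 | LkScale _ => 1 end.

Definition lk_sig (K : fieldType) : signature :=
  {| fsym := lk_fsym K;
     fsym_arity := @lk_fsym_arity K;
     rsym := lk_rsym K;
     rsym_arity := fun=> 2 |}.

Definition bilin_structure (K : fieldType) (V : bilin_space K) :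
    fo_structure (lk_sig K) :=
  @FoStructure (lk_sig K) V
    (fun s =>
       match s return ('I_(lk_fsym_arity s) -> V) -> V with
       | LkZero => fun=> 0
       | LkAdd => fun a => a ord0 + a ord_max
       | LkOpp => fun a => - a ord0
       | LkScale l => fun a => l *: a ord0
       end)
    (fun r (a : 'I_2 -> V) =>
       match r with
       | LkNeq => a ord0 <> a ord_max
       | LkForm l => bs_form V (a ord0) (a ord_max) = l
       end).

(* All h-inductive sentences true in every bilinear space of the class. *)
Definition bilin_theory (K : fieldType) (c : bilin_class) : theory (lk_sig K) :=
  fun s => forall V : bilin_space K, in_class c V -> holds (bilin_structure V) s.

Arguments bilin_theory K c : clear implicits.

(* Main.v *)
From HB Require Import structures.
Require Import Defs.
From mathcomp Require Import all_boot all_order all_algebra.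
From mathcomp Require Import ring boolp classical_sets.

Set Implicit Arguments.
Unset Strict Implicit.
Unset Printing Implicit Defensive.

Import GRing.Theory VectorInternalTheory.
Local Open Scope ring_scope.

(** A model of the theory is a vector space, because the vector space axioms are
    h-inductive, together with a form that may be undefined on some pairs: that
    [[x, y]] has some value is an infinite disjunction when [K] is infinite.
    Totality is therefore the first point to settle.

    Existentially closed models are finitely injective spaces. The requirements
    on a total form extending the partial one (bilinearity, the symmetry class,
    the known values) are linear equations in the unknown values [b x y].
    Finitely many of them can be solved, since otherwise their inconsistency
    would be an h-inductive sentence of the theory that fails in the model;
    hence all of them can, by compactness of linear systems over a field
    ([linear_compactness]). So every model maps identically to a bilinear space
    on the same vector space ([model_form]); if the model is existentially
    closed, this map is an immersion and the model is itself a bilinear space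
    ([ec_model_bilin]). Let now [f : A -> W] be a monomorphism from a subspace
    of a finite dimensional [B]. The spaces [W] and [B] have an amalgam [N] over
    [A] ([amalgamation]), and [W] is immersed in [N], so a positive formula
    describing the values of the form on a basis of [B], and how [A] sits in
    [B], can be pulled back to [W] ([immersion_pullback]). This gives an
    isometry [B -> W] extending [f]. A positive formula cannot express linear
    independence over an infinite field, but an isometry of a non-degenerate
    space is injective; so [B] is first embedded in a non-degenerate space of
    the same class, its hyperbolic extension.

    Finitely injective spaces are infinite dimensional and non-degenerate. Zero
    forms of arbitrarily large dimension embed in a finitely injective [W]. A
    vector [x != 0] spans a line, and extending the inclusion of that line to
    its hyperbolic extension produces a [y] with [[x, y] != 0], and another with
    [[y, x] != 0].

    Finitely injective spaces are existentially closed. Any model receiving a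
    homomorphism from [W] maps further to a bilinear space [N] of the class, so
    it is enough that every isometric embedding [W -> N] is an immersion. This
    is a one-sided back and forth argument ([back_and_forth]): a finite
    dimensional space embedded in both [N] and [W] can be enlarged to contain
    any given vector of [N], and by finite injectivity the embedding in [W]
    follows. *)

(** * Homomorphisms, immersions and atomic formulas *)

Lemma comp_extend L (M N : fo_structure L) (f : M -> N) n x (a : 'I_n -> M) :
  f \o extend x a = extend (f x) (f \o a).
Proof. by apply/funext => i; rewrite /extend /=; case: (unlift ord0 i). Qed.

Lemma extend0 L (M : fo_structure L) n (x : M) (a : 'I_n -> M) :
  extend x a ord0 = x.
Proof. by rewrite /extend unlift_none. Qed.

Lemma extend_lift L (M : fo_structure L) n (x : M) (a : 'I_n -> M) i :
  extend x a (lift ord0 i) = a i.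
Proof. by rewrite /extend liftK. Qed.

Definition commutes_with_functions L (M N : fo_structure L) (f : M -> N) :=
  forall s a, f (@fun_interp L M s a) = @fun_interp L N s (f \o a).

Lemma eval_comp L (M N : fo_structure L) (f : M -> N) n (a : 'I_n -> M) t :
  commutes_with_functions f -> eval (f \o a) t = f (eval a t).
Proof.
move=> fF; elim: t => //= s ts IH.
by rewrite fF; congr fun_interp; apply/funext => i; rewrite IH.
Qed.

(** Positive formulas contain no negation, so every connective propagates the
    preservation of atomic formulas. *)
Lemma homomorphism_of_atomic L (M N : fo_structure L) (f : M -> N) :
  commutes_with_functions f ->
  (forall r a, @rel_interp L M r a -> @rel_interp L N r (f \o a)) ->
  homomorphism f.
Proof.
move=> fF fR n p; elim: p => {n} //=.
- by move=> n t u a; rewrite !eval_comp // => ->.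
- move=> n r ts a /fR.
  rewrite (_ : f \o _ = fun i => eval (f \o a) (ts i)) //.
  by apply/funext => i /=; rewrite eval_comp.
- by move=> n p IHp q IHq a [/IHp ? /IHq].
- by move=> n p IHp q IHq a [/IHp|/IHq]; [left|right].
- by move=> n p IHp a [x /IHp]; rewrite comp_extend => ?; exists (f x).
Qed.

(** The graph of a function symbol is an atomic formula. *)
Lemma homomorphism_fun L (M N : fo_structure L) (f : M -> N) :
  homomorphism f -> commutes_with_functions f.
Proof.
move=> fH s a.
pose p : formula L (fsym_arity s).+1 :=
  Eq (Var L ord0) (App (fun i => Var L (lift ord0 i))).
have := fH _ p (extend (@fun_interp L M s a) a).
rewrite comp_extend /= !extend0 => -> //.
  by congr fun_interp; apply/funext => i; rewrite extend_lift.
by congr fun_interp; apply/funext => i; rewrite extend_lift.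
Qed.

Definition rel_formula L (r : rsym L) : formula L (rsym_arity r) :=
  Rel (fun i => Var L i).

Lemma homomorphism_rel L (M N : fo_structure L) (f : M -> N) r a :
  homomorphism f -> @rel_interp L M r a -> @rel_interp L N r (f \o a).
Proof. by move=> fH; exact: (fH _ (rel_formula r)). Qed.

Lemma immersion_rel L (M N : fo_structure L) (f : M -> N) r a :
  immersion f -> @rel_interp L M r a <-> @rel_interp L N r (f \o a).
Proof.
move=> [fH fR]; split; first exact: homomorphism_rel.
exact: (fR _ (rel_formula r)).
Qed.

Lemma homomorphism_comp L (M N P : fo_structure L) (f : M -> N) (g : N -> P) :
  homomorphism f -> homomorphism g -> homomorphism (g \o f).
Proof. by move=> fH gH n p a /fH /gH. Qed.

Lemma immersion_of_comp L (M N P : fo_structure L) (f : M -> N) (g : N -> P) :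
  homomorphism f -> homomorphism g -> immersion (g \o f) -> immersion f.
Proof. by move=> fH gH [_ gfR]; split=> // n p a /gH; exact: gfR. Qed.

Lemma fo_structure_eq L (M : fo_structure L) F R :
  (forall s a, @fun_interp L M s a = F s a) ->
  (forall r a, @rel_interp L M r a <-> R r a) ->
  M = @FoStructure L M F R.
Proof.
case: M F R => D F0 R0 F R /= eF eR.
have -> : F0 = F by apply/functional_extensionality_dep => s; apply/funext.
suff -> : R0 = R by [].
apply/functional_extensionality_dep => r; apply/funext => a.
exact/propext.
Qed.

Fixpoint conjunction L n (ps : seq (formula L n)) : formula L n :=
  if ps is p :: ps' then And p (conjunction ps') else Top L n.

Lemma sat_conjunction L (M : fo_structure L) n (T : eqType) (s : seq T)
    (F : T -> formula L n) (a : 'I_n -> M) :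
  sat (conjunction [seq F x | x <- s]) a <-> forall x, x \in s -> sat (F x) a.
Proof.
elim: s => [|x s IH] /=; first by [].
split=> [[Fx /IH Fs] y|Fs].
  by rewrite inE => /predU1P[->//|]; exact: Fs.
split; first by apply: Fs; rewrite mem_head.
by apply/IH => y ys; apply: Fs; rewrite inE ys orbT.
Qed.

(** The [k] quantified variables come first, so that the binder [Ex], which
    acts on variable [ord0], can be iterated; the last [m] variables remain as
    parameters. *)
Fixpoint exs L m k : formula L (k + m) -> formula L m :=
  match k with
  | 0 => id
  | k'.+1 => fun p => exs (Ex (p : formula L (k' + m).+1))
  end.

Lemma sat_exs L (M : fo_structure L) m k (p : formula L (k + m))
    (a : 'I_m -> M) :
  sat (exs p) a <->
  exists b : 'I_(k + m) -> M, (forall i, b (rshift k i) = a i) /\ sat p b.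
Proof.
elim: k p => [|k IH] p.
  split=> [pa|[b [ba]]].
    exists a; split=> // i; congr a; exact: val_inj.
  rewrite (_ : b = a) //; apply/funext => i; rewrite -ba.
  congr b; exact: val_inj.
have lift_rshift (i : 'I_m) :
    rshift k.+1 i = lift ord0 (rshift k i) :> 'I_(k + m).+1.
  exact: val_inj.
split=> [/IH[b [ba [x px]]]|[b [ba pb]]].
  by exists (extend x b); split=> // i; rewrite lift_rshift extend_lift.
apply/IH; exists (fun i => b (lift ord0 i)); split.
  by move=> i; rewrite -lift_rshift.
exists (b ord0); rewrite (_ : extend _ _ = b) //.
apply/funext => i; rewrite /extend.
by case: unliftP => [j|] ->.
Qed.

(** * Consequences of the axiom of choice in linear algebra *)

(** The pair [([:: (c_1, i_1); ...; (c_n, i_n)], l)] encodes the equation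
    [c_1 * u i_1 + ... + c_n * u i_n = l]. *)
Definition lin_eqn (K : fieldType) (I : eqType) : eqType :=
  (seq (K * I) * K)%type.

Definition solves (K : fieldType) (I : eqType) (u : I -> K) (e : lin_eqn K I) :=
  \sum_(p <- e.1) p.1 * u p.2 = e.2.

Definition finitely_solvable (K : fieldType) (I : eqType)
    (S : set (lin_eqn K I)) :=
  forall l : seq (lin_eqn K I), (forall e, e \in l -> S e) ->
  exists u, forall e, e \in l -> solves u e.

Lemma solves_affine (K : fieldType) (I : eqType) (u v : I -> K) t
    (e : lin_eqn K I) :
  solves u e -> solves v e -> solves (fun i => u i + t * (v i - u i)) e.
Proof.
rewrite /solves => ue ve.
under eq_bigr do rewrite mulrDr mulrCA mulrBr mulrBr.
rewrite big_split /= sumrB -!mulr_sumr ue ve subrr addr0 //.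
Qed.

Local Notation assign l i := (([:: (1, i)], l) : lin_eqn _ _).

Lemma solves_assign (K : fieldType) (I : eqType) (u : I -> K) l i :
  solves u (assign l i) <-> u i = l.
Proof. by rewrite /solves /= big_seq1 /= mul1r. Qed.

(** By Zorn's lemma there is a maximal set [G] of equations [u i = l] that can
    be added to [S] without losing finite solvability.  Such a [G] assigns a
    value to every unknown [i]: if [u i = 0] is refuted by a finite part [s0]
    of the system and [u0] solves [s0], then [u i = u0 i] cannot be refuted
    too, as two solutions of [s0] that differ at [i] have an affine combination
    vanishing at [i]. *)
Lemma linear_compactness (K : fieldType) (I : eqType)
    (S : set (lin_eqn K I)) :
  finitely_solvable S -> exists u, forall e, S e -> solves u e.
Proof.
move=> Sfin.
pose P (G : set (lin_eqn K I)) := finitely_solvable (S `|` G)%classic.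
have [F FP Ftot|G [GP Gmax]] := @Zorn_bigcup _ P.
  move=> l lF.
  have [Sl|[X FX Xl]] : (forall e, e \in l -> S e) \/
      exists2 X, F X & forall e, e \in l -> (S `|` X)%classic e.
    elim: l lF => [|e l IH] lF; first by left.
    have {}IH := IH (fun e' e'l =>
      lF e' (mem_behead (e'l : e' \in behead (e :: l)))).
    have [Se|[X FX Xe]] := lF e (mem_head e l).
      case: IH => [Sl|[X FX Xl]]; [left|right].
        by move=> e'; rewrite inE => /predU1P[->|/Sl].
      by exists X => // e'; rewrite inE => /predU1P[->|/Xl]; [left|].
    right; case: IH => [Sl|[Y FY Yl]].
      by exists X => // e'; rewrite inE => /predU1P[->|/Sl]; [right|left].
    have [XY|YX] := Ftot _ _ FX FY.
      by exists Y => // e'; rewrite inE => /predU1P[->|/Yl//]; right; exact: XY.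
    exists X => // e'; rewrite inE => /predU1P[->|/Yl[]]; first by right.
      by left.
    by right; exact: YX.
    exact: Sfin.
  exact: FP FX _ Xl.
have assigned i : exists l, G (assign l i).
  have refute l : ~ G (assign l i) ->
      exists2 s : seq (lin_eqn K I),
        (forall e, e \in s -> (S `|` G)%classic e) &
        forall u, (forall e, e \in s -> solves u e) -> u i <> l.
    move=> Gl.
    have /existsNP[s /not_implyP[sG /forallNP sN]] :
        ~ P (G `|` [set assign l i])%classic.
      apply: Gmax; split; first by move=> e; left.
      by move=> sub; apply: Gl; apply: sub; right.
    exists [seq e <- s | e != assign l i] => [e|u us uil].
      by rewrite mem_filter => /andP[/eqP ne /sG[|[]]]; [left|right|].
    apply: (sN u) => e es; have [->|ne] := eqVneq e (assign l i).
      exact/solves_assign.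
    by apply: us; rewrite mem_filter ne.
  apply/not_existsP => noG.
  have [s0 s0G s0N] := refute 0 (noG 0).
  have [u0 u0s] := GP _ s0G.
  have [s1 s1G s1N] := refute (u0 i) (noG (u0 i)).
  have [|u us] := GP (s0 ++ s1).
    by move=> e; rewrite mem_cat => /orP[/s0G|/s1G].
  have u01 : u i - u0 i != 0.
    rewrite subr_eq0; apply/eqP; apply: s1N => e es.
    by apply: us; rewrite mem_cat es orbT.
  (* the point of the line through [u0] and [u] that vanishes at [i] *)
  apply: (s0N (fun j => u0 j + - u0 i / (u i - u0 i) * (u j - u0 j))).
    move=> e es; apply: solves_affine; first exact: u0s.
    by apply: us; rewrite mem_cat es.
  by rewrite divfK // subrr.
have [u uG] := choice assigned.
exists u => e Se.
(* [v] solves [e] and agrees with [u] on the unknowns occurring in [e] *)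
have [|v vs] := GP (e :: [seq assign (u p.2) p.2 | p <- e.1]).
  move=> e'; rewrite inE => /predU1P[->|/mapP[p _ ->]]; first by left.
  by right; exact: uG.
rewrite /solves -(vs e (mem_head _ _)).
apply: eq_big_seq => p pe; congr (_ * _); apply/esym/(solves_assign v).
by apply: vs; rewrite inE; apply/orP; right; apply/mapP; exists p.
Qed.

Definition mk_linear (K : fieldType) (U V : lmodType K) (f : U -> V)
  of linear f : U -> V := f.

HB.instance Definition _ (K : fieldType) (U V : lmodType K) (f : U -> V)
    (fL : linear f) :=
  GRing.isLinear.Build K U V *:%R (mk_linear fL) fL.

(** A maximal subspace [U] with [U :&: f A = 0] is a complement of the image of
    [f], and [r] is the projection along it. *)
Lemma linear_retraction (K : fieldType) (A W : lmodType K)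
    (f : {linear A -> W}) :
  injective f -> exists r : {linear W -> A}, cancel f r.
Proof.
move=> f_inj.
have f0 a : f a = 0 -> a = 0 by rewrite -(raddf0 f) => /f_inj.
pose P (U : set W) := [/\ forall k x y, U x -> U y -> U (k *: x + y) &
  forall a, U (f a) -> a = 0].
have [F FP Ftot|U [[UL Uf] Umax]] := @Zorn_bigcup _ P.
  split=> [k x y [X FX Xx] [Y FY Yy]|a [X FX]]; last exact: (FP _ FX).2.
  have [XY|YX] := Ftot _ _ FX FY.
    by exists Y => //; apply: (FP _ FY).1 => //; exact: XY.
  by exists X => //; apply: (FP _ FX).1 => //; exact: YX.
have UZ x y k : U x -> U y -> U (x - k *: y).
  by move=> Ux Uy; rewrite addrC -scaleNr; exact: UL.
(* the union of an empty chain is empty, so [0] is not built into [P] *)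
have U0 : U 0.
  have [[u0 Uu0]|noU] := pselect (exists u0, U u0).
    by have := UZ u0 u0 1 Uu0 Uu0; rewrite scale1r subrr.
  have [] := Umax [set 0]%classic.
    split; first by move=> x Ux; case: noU; exists x.
    by move=> sub; apply: noU; exists 0; apply: sub.
  split=> [k x y -> ->|a]; first by rewrite scaler0 addr0.
  by move=> /f0.
have decomposition w : exists a, U (w - f a).
  apply/not_existsP => noa.
  have [] := Umax [set x | exists k u, U u /\ x = k *: w + u]%classic.
    split=> [x Ux|sub]; first by exists 0, x; rewrite scale0r add0r.
    apply: (noa 0); rewrite raddf0 subr0; apply: sub.
    by exists 1, 0; rewrite scale1r addr0.
  split=> [k _ _ [k1 [u1 [U1 ->]]] [k2 [u2 [U2 ->]]]|a [k [u [Uu fa]]]].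
    exists (k * k1 + k2), (k *: u1 + u2); split; first exact: UL.
    by rewrite scalerDr addrACA scalerA -scalerDl.
  have [k0|k0] := eqVneq k 0; first by apply: Uf; rewrite fa k0 scale0r add0r.
  case: (noa (k^-1 *: a)).
  rewrite linearZ /= fa scalerDr scalerA mulVf // scale1r opprD addNKr.
  by rewrite -[X in U X]add0r; exact: UZ.
have [r rU] := choice decomposition.
have r_uniq w a : U (w - f a) -> r w = a.
  move=> Ua; apply/eqP; rewrite -subr_eq0; apply/eqP/Uf.
  have := UZ _ _ 1 Ua (rU w).
  by rewrite scale1r [f (_ - _)]raddfB opprB addrC addrA subrK.
have rL : linear r.
  move=> k x y; apply: r_uniq; rewrite linearP /= opprD addrACA -scalerBr.
  by apply: UL; exact: rU.
exists (mk_linear rL) => a; apply: r_uniq; by rewrite subrr.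
Qed.

(** * The vector space underlying a model *)

Section PairFamily.
Variable T : Type.

Definition no_family (i : 'I_0) : T := False_rect T (notF (ltn_ord i)).

Definition pair_family (x y : T) (i : 'I_2) : T := if i == ord0 then x else y.

Lemma no_familyE (a : 'I_0 -> T) : a = no_family.
Proof. by apply/funext => -[]. Qed.

Lemma pair_familyE (a : 'I_2 -> T) : a = pair_family (a ord0) (a ord_max).
Proof.
apply/funext => i; rewrite /pair_family; case: eqP => [->//|/eqP i0].
by congr a; apply: val_inj; case: i i0 => [[|[|]]].
Qed.

End PairFamily.

(** The symbols of the signature take families indexed by ordinals as arguments;
    here they become ordinary operations, on a structure ([st_]) and on terms
    ([t_]). *)
Section LinearTerms.
Variables (K : fieldType) (M : fo_structure (lk_sig K)).

Definition st_zero : M := @fun_interp _ M LkZero (no_family M).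
Definition st_opp (x : M) : M := @fun_interp _ M LkOpp (fun=> x).
Definition st_add (x y : M) : M := @fun_interp _ M LkAdd (pair_family x y).
Definition st_scale l (x : M) : M := @fun_interp _ M (LkScale l) (fun=> x).

Variable n : nat.
Implicit Types t u : term (lk_sig K) n.

Definition t_zero :=
  @App (lk_sig K) n LkZero (no_family (term (lk_sig K) n)).
Definition t_opp t := @App (lk_sig K) n LkOpp (fun=> t).
Definition t_add t u := @App (lk_sig K) n LkAdd (pair_family t u).
Definition t_scale l t := @App (lk_sig K) n (LkScale l) (fun=> t).

Variable a : 'I_n -> M.

Lemma eval_zero : eval a t_zero = st_zero.
Proof. by rewrite /= [X in fun_interp X]no_familyE. Qed.

Lemma eval_opp t : eval a (t_opp t) = st_opp (eval a t).
Proof. by []. Qed.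

Lemma eval_add t u : eval a (t_add t u) = st_add (eval a t) (eval a u).
Proof. by rewrite /= [X in fun_interp X]pair_familyE. Qed.

Lemma eval_scale l t : eval a (t_scale l t) = st_scale l (eval a t).
Proof. by []. Qed.

Definition t_neq t u := @Rel (lk_sig K) n LkNeq (pair_family t u).
Definition t_form l t u :=
  @Rel (lk_sig K) n (LkForm l) (pair_family t u).

Definition st_neq (x y : M) := @rel_interp _ M LkNeq (pair_family x y).
Definition st_form l (x y : M) := @rel_interp _ M (LkForm l) (pair_family x y).

Lemma sat_neq t u : sat (t_neq t u) a <-> st_neq (eval a t) (eval a u).
Proof. by rewrite /= [X in rel_interp X]pair_familyE. Qed.

Lemma sat_form l t u : sat (t_form l t u) a <-> st_form l (eval a t) (eval a u).
Proof. by rewrite /= [X in rel_interp X]pair_familyE. Qed.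

End LinearTerms.

Definition eval_linear := (eval_zero, eval_opp, eval_add, eval_scale).

Arguments t_zero {K n}.

Lemma bilin_structure_model (K : fieldType) c (W : bilin_space K) :
  in_class c W -> model (bilin_theory K c) (bilin_structure W).
Proof. by move=> Wc s; exact. Qed.

Section ModelAxioms.
Variables (K : fieldType) (c : bilin_class) (M : fo_structure (lk_sig K)).
Hypothesis HM : model (bilin_theory K c) M.

Lemma model_eq n (t u : term (lk_sig K) n) (a : 'I_n -> M) :
  (forall (W : bilin_space K) (b : 'I_n -> W),
     eval (M := bilin_structure W) b t = eval (M := bilin_structure W) b u) ->
  eval a t = eval a u.
Proof.
move=> tu; suff /HM : bilin_theory K c (HInductive (Top _ n) (Eq t u)).
  by move=> /(_ a I).
by move=> W _ b _; exact: tu.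
Qed.

(** If no space satisfied [p], then [p -> Bot] would belong to the theory. *)
Lemma model_consistent n (p : formula (lk_sig K) n) (a : 'I_n -> M) :
  sat p a -> exists2 W : bilin_space K, in_class c W &
    exists b : 'I_n -> W, sat (M := bilin_structure W) p b.
Proof.
move=> pa; apply: contrapT => noW.
suff /HM/(_ a pa) : bilin_theory K c (HInductive p (Bot _ n)) by [].
by move=> W Wc b pb; apply: noW; exists W => //; exists b.
Qed.

Lemma model_neq (x y : M) : st_neq x y <-> x <> y.
Proof.
pose a : 'I_2 -> M := pair_family x y.
pose t0 : term (lk_sig K) 2 := Var _ ord0.
pose t1 : term (lk_sig K) 2 := Var _ ord_max.
split=> [xy exy|xy].
  have [|W _ [b /= []]] := @model_consistent 2 (And (t_neq t0 t1) (Eq t0 t1)) a.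
    by split=> //; apply/sat_neq.
  by [].
suff /HM/(_ a I) /= [//|/sat_neq//] :
    bilin_theory K c (HInductive (Top _ 2) (Or (Eq t0 t1) (t_neq t0 t1))).
move=> W _ b _ /=; have [->|] := pselect (b ord0 = b ord_max); first by left.
by right.
Qed.

Let x0 : term (lk_sig K) 3 := Var _ (@Ordinal 3 0 isT).
Let x1 : term (lk_sig K) 3 := Var _ (@Ordinal 3 1 isT).
Let x2 : term (lk_sig K) 3 := Var _ (@Ordinal 3 2 isT).
Let triple (x y z : M) (i : 'I_3) := nth x [:: x; y; z] i.

Lemma model_addA : associative (@st_add K M).
Proof.
move=> x y z.
have := @model_eq 3 (t_add x0 (t_add x1 x2)) (t_add (t_add x0 x1) x2)
  (triple x y z).
by rewrite !eval_linear; apply => W b; exact: addrA.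
Qed.

Lemma model_addC : commutative (@st_add K M).
Proof.
move=> x y; have := @model_eq 3 (t_add x0 x1) (t_add x1 x0) (triple x y y).
by rewrite !eval_linear; apply => W b; exact: addrC.
Qed.

Lemma model_add0 : left_id (st_zero M) (@st_add K M).
Proof.
move=> x; have := @model_eq 3 (t_add t_zero x0) x0 (triple x x x).
by rewrite !eval_linear; apply => W b; exact: add0r.
Qed.

Lemma model_addN : left_inverse (st_zero M) (@st_opp K M) (@st_add K M).
Proof.
move=> x; have := @model_eq 3 (t_add (t_opp x0) x0) t_zero (triple x x x).
by rewrite !eval_linear; apply => W b; exact: addNr.
Qed.

Lemma model_scaleA k l (x : M) :
  st_scale k (st_scale l x) = st_scale (k * l) x.
Proof.
have := @model_eq 3 (t_scale k (t_scale l x0)) (t_scale (k * l) x0)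
  (triple x x x).
by rewrite !eval_linear; apply => W b; exact: scalerA.
Qed.

Lemma model_scale1 : left_id 1 (@st_scale K M).
Proof.
move=> x; have := @model_eq 3 (t_scale 1 x0) x0 (triple x x x).
by rewrite !eval_linear; apply => W b; exact: scale1r.
Qed.

Lemma model_scaleDr : right_distributive (@st_scale K M) (@st_add K M).
Proof.
move=> k x y.
have := @model_eq 3 (t_scale k (t_add x0 x1))
  (t_add (t_scale k x0) (t_scale k x1)) (triple x y y).
by rewrite !eval_linear; apply => W b; exact: scalerDr.
Qed.

Lemma model_scaleDl x :
  {morph (@st_scale K M)^~ x : k l / k + l >-> st_add k l}.
Proof.
move=> k l; have := @model_eq 3 (t_scale (k + l) x0)
  (t_add (t_scale k x0) (t_scale l x0)) (triple x x x).
by rewrite !eval_linear; apply => W b; exact: scalerDl.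
Qed.

End ModelAxioms.

(** The carrier is that of [M]; the model hypothesis is kept as a parameter for
    the vector space structure to be found from the type. *)
Definition model_space (K : fieldType) (c : bilin_class)
  (M : fo_structure (lk_sig K)) of model (bilin_theory K c) M : Type := M.

Section ModelSpace.
Variables (K : fieldType) (c : bilin_class) (M : fo_structure (lk_sig K)).
Variable HM : model (bilin_theory K c) M.
Local Notation W := (model_space HM).

HB.instance Definition _ := gen_eqMixin W.
HB.instance Definition _ := gen_choiceMixin W.
HB.instance Definition _ := GRing.isZmodule.Build W
  (model_addA HM) (model_addC HM) (model_add0 HM) (model_addN HM).
HB.instance Definition _ := GRing.Zmodule_isLmodule.Build K W
  (model_scaleA HM) (model_scale1 HM) (model_scaleDr HM) (model_scaleDl HM).

(** A finite part of the structure of a model is realized in a bilinear space: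
    a triple [(k, x, y)] stands in [L] for the value of [k *: x + y], and in [F]
    for the fact that the form takes the value [k] at [x] and [y]. *)
Lemma partial_homomorphism (L F : seq (K * W * W)) :
  (forall q, q \in F -> st_form (M := M) q.1.1 q.1.2 q.2) ->
  exists2 N : bilin_space K, in_class c N & exists2 h : W -> N,
    (forall q, q \in L ->
       h (q.1.1 *: q.1.2 + q.2) = q.1.1 *: h q.1.2 + h q.2) &
    (forall q, q \in F -> bs_form N (h q.1.2) (h q.2) = q.1.1).
Proof.
move=> FM.
pose s : seq W := (0 : W) ::
  flatten [seq [:: q.1.2; q.2; q.1.1 *: q.1.2 + q.2] | q <- L] ++
  flatten [seq [:: q.1.2; q.2] | q <- F].
pose a (i : 'I_(size s)) : M := nth (0 : W) s i.
(* the vectors occurring in [L] and [F] become variables; as [0] is listed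
   first, the variables form a nonempty type and [ix] is total *)
pose ix (x : W) : 'I_(size s) := inord (index x s).
have aix x : x \in s -> a (ix x) = x.
  by move=> xs; rewrite /a inordK ?nth_index // index_mem.
have Ls q :
    q \in L -> [/\ q.1.2 \in s, q.2 \in s & q.1.1 *: q.1.2 + q.2 \in s].
  move=> qL.
  suff sub x : x \in [:: q.1.2; q.2; q.1.1 *: q.1.2 + q.2] -> x \in s.
    by split; apply: sub; rewrite !inE eqxx ?orbT.
  move=> xq; rewrite inE mem_cat; apply/orP; right; apply/orP; left.
  by apply/flatten_mapP; exists q.
have Fs q : q \in F -> (q.1.2 \in s) /\ (q.2 \in s).
  move=> qF; suff sub x : x \in [:: q.1.2; q.2] -> x \in s.
    by split; apply: sub; rewrite !inE eqxx ?orbT.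
  move=> xq; rewrite inE mem_cat; apply/orP; right; apply/orP; right.
  by apply/flatten_mapP; exists q.
pose v x : term (lk_sig K) _ := Var _ (ix x).
pose pL (q : K * W * W) :=
  Eq (v (q.1.1 *: q.1.2 + q.2)) (t_add (t_scale q.1.1 (v q.1.2)) (v q.2)).
pose pF (q : K * W * W) := t_form q.1.1 (v q.1.2) (v q.2).
have [|N Nc [b [bL bF]]] :=
    @model_consistent _ _ _ HM _
      (And (conjunction [seq pL q | q <- L])
           (conjunction [seq pF q | q <- F])) a.
  split; apply/sat_conjunction => q.
    move=> /Ls[qs1 qs2 qs3]; change (a (ix (q.1.1 *: q.1.2 + q.2)) =
      eval a (t_add (t_scale q.1.1 (v q.1.2)) (v q.2))).
    by rewrite !eval_linear /= !aix.
  move=> qF; have [qs1 qs2] := Fs _ qF.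
  by apply/sat_form; rewrite /= !aix //; exact: FM.
have {}bL := (sat_conjunction (M := bilin_structure N) L pL b).1 bL.
have {}bF := (sat_conjunction (M := bilin_structure N) F pF b).1 bF.
exists N => //; exists (b \o ix) => q; first exact: bL.
exact: bF.
Qed.

End ModelSpace.

(** * Bilinear forms *)

Definition mk_form (K : fieldType) (U : lmodType K) (f : U -> U -> K)
  of (forall y, scalar (f^~ y)) & (forall x, scalar (f x)) := f.

HB.instance Definition _ (K : fieldType) (U : lmodType K) (f : U -> U -> K)
    (fl : forall y, scalar (f^~ y)) (fr : forall x, scalar (f x)) :=
  bilinear_isBilinear.Build K U U K *%R *%R (mk_form fl fr) (pair fl fr).

Lemma in_class_symmetric (K : fieldType) c (N : bilin_space K) :
  c = SymmetricForms -> in_class c N ->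
  forall x y, bs_form N x y = bs_form N y x.
Proof. by move->. Qed.

Lemma in_class_alternating (K : fieldType) c (N : bilin_space K) :
  c = AlternatingForms -> in_class c N -> forall x, bs_form N x x = 0.
Proof. by move->. Qed.

Section ModelForm.
Variables (K : fieldType) (c : bilin_class) (M : fo_structure (lk_sig K)).
Variable HM : model (bilin_theory K c) M.
Local Notation W := (model_space HM).

Definition on_pairs T (b : T -> T -> K) (p : T * T) : K := b p.1 p.2.

(** The linear system whose solutions are the bilinear forms of the class that
    extend the partial form of the model. *)
Inductive form_eqn : set (lin_eqn K (W * W)%type) :=
| LeftLinear k x x' y : form_eqn
    ([:: (1, (k *: x + x', y)); (- k, (x, y)); (- 1, (x', y))], 0)
| RightLinear k x y y' : form_eqn
    ([:: (1, (x, k *: y + y')); (- k, (x, y)); (- 1, (x, y'))], 0)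
| Symmetry x y of c = SymmetricForms :
    form_eqn ([:: (1, (x, y)); (- 1, (y, x))], 0)
| Alternation x of c = AlternatingForms : form_eqn ([:: (1, (x, x))], 0)
| Known l x y of st_form (M := M) l x y : form_eqn ([:: (1, (x, y))], l).

(** Finitely many of the equations only involve finitely many linear relations
    and known values; the form pulled back along the map that realizes these is
    a solution. *)
Lemma form_eqn_solvable : finitely_solvable form_eqn.
Proof.
pose ok (L : seq (K * W * W)) (N : bilin_space K) (h : W -> N) := forall q,
  q \in L -> h (q.1.1 *: q.1.2 + q.2) = q.1.1 *: h q.1.2 + h q.2.
pose okF (F : seq (K * W * W)) (N : bilin_space K) (h : W -> N) := forall q,
  q \in F -> bs_form N (h q.1.2) (h q.2) = q.1.1.
move=> l lS.
suff [L [F [FM LF]]] : exists L F : seq (K * W * W),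
    (forall q, q \in F -> st_form (M := M) q.1.1 q.1.2 q.2) /\
    forall (N : bilin_space K) (h : W -> N), in_class c N ->
      ok L N h -> okF F N h -> forall e, e \in l ->
      solves (on_pairs (fun x y => bs_form N (h x) (h y))) e.
  have [N Nc [h hL hF]] := partial_homomorphism L FM.
  by exists (on_pairs (fun x y => bs_form N (h x) (h y))); exact: LF.
elim: l lS => [|e l IH] lS; first by exists [::], [::].
have [L [F [FM LF]]] : exists L F : seq (K * W * W),
    (forall q, q \in F -> st_form (M := M) q.1.1 q.1.2 q.2) /\
    forall (N : bilin_space K) (h : W -> N), in_class c N ->
      ok L N h -> okF F N h ->
      solves (on_pairs (fun x y => bs_form N (h x) (h y))) e.
  case: (lS e (mem_head _ _)) => [k x x' y|k x y y'|x y cE|x cE|k x y kxy].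
  - exists [:: (k, x, x')], [::]; split=> // N h _ hL _.
    rewrite /solves /on_pairs !big_cons big_nil /=.
    rewrite (hL (k, x, x')) ?mem_head //= linearPl /=.
    by rewrite !mul1r !mulN1r mulNr addr0 -opprD subrr.
  - exists [:: (k, y, y')], [::]; split=> // N h _ hL _.
    rewrite /solves /on_pairs !big_cons big_nil /=.
    rewrite (hL (k, y, y')) ?mem_head //= linearPr /=.
    by rewrite !mul1r !mulN1r mulNr addr0 -opprD subrr.
  - exists [::], [::]; split=> // N h /(in_class_symmetric cE) Nc _ _.
    rewrite /solves /on_pairs !big_cons big_nil /= (Nc (h x)).
    by rewrite mul1r mulN1r addr0 subrr.
  - exists [::], [::]; split=> // N h /(in_class_alternating cE) Nc _ _.
    by rewrite /solves /on_pairs big_seq1 /= (Nc (h x)) mulr0.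
  - exists [::], [:: (k, x, y)]; split=> [q|N h _ _ hF].
      by rewrite inE => /eqP ->.
    by apply/solves_assign; exact: (hF (k, x, y) (mem_head _ _)).
have [L' [F' [FM' LF']]] :=
  IH (fun e' e'l => lS e' (mem_behead (e'l : e' \in behead (e :: l)))).
exists (L ++ L'), (F ++ F'); split=> [q|N h Nc hL hF e'].
  by rewrite mem_cat => /orP[/FM|/FM'].
rewrite inE => /predU1P[->|].
  apply: LF => // q qs; [apply: hL|apply: hF]; by rewrite mem_cat qs.
apply: LF' => // q qs; [apply: hL|apply: hF]; by rewrite mem_cat qs orbT.
Qed.

Lemma model_form : exists b : {bilinear W -> W -> K | *%R & *%R},
  in_class c (BilinSpace W b) /\
  forall l x y, st_form (M := M) l x y -> b x y = l.
Proof.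
have [u uS] := linear_compactness form_eqn_solvable.
have ul y : scalar ((fun x => u (x, y))).
  move=> k x x'; have := uS _ (LeftLinear k x x' y).
  rewrite /solves !big_cons big_nil /= addr0 mul1r mulNr mulN1r -opprD.
  by move/eqP; rewrite subr_eq0 => /eqP.
have ur x : scalar ((fun y => u (x, y))).
  move=> k y y'; have := uS _ (RightLinear k x y y').
  rewrite /solves !big_cons big_nil /= addr0 mul1r mulNr mulN1r -opprD.
  by move/eqP; rewrite subr_eq0 => /eqP.
exists (mk_form ul ur); split=> [|l x y lxy]; last first.
  by apply/(solves_assign u)/uS; exact: Known.
(* the type of [u] depends on [c], so the case analysis is on a copy of it *)
suff class_eq d : c = d -> in_class d (BilinSpace W (mk_form ul ur)).
  exact: class_eq.
case: d => //= cE => [x y|x]; rewrite /mk_form.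
  have := uS _ (Symmetry x y cE).
  rewrite /solves !big_cons big_nil /= addr0 mul1r mulN1r.
  by move/eqP; rewrite subr_eq0 => /eqP.
exact/(solves_assign u)/uS/Alternation.
Qed.

Section Interpretation.
Variable b : {bilinear W -> W -> K | *%R & *%R}.
Local Notation N := (bilin_structure (BilinSpace W b)).

Lemma model_fun s a : @fun_interp _ M s a = @fun_interp _ N s a.
Proof.
case: s a => [|||l] a /=.
- by rewrite [a]no_familyE.
- by rewrite [a in LHS]pair_familyE.
- rewrite [a in LHS](_ : a = fun=> a ord0) //.
  by apply/funext => i; rewrite (ord1 i).
- rewrite [a in LHS](_ : a = fun=> a ord0) //.
  by apply/funext => i; rewrite (ord1 i).
Qed.

Lemma model_rel_neq a :
  @rel_interp _ M LkNeq a <-> @rel_interp _ N LkNeq a.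
Proof. by rewrite [a in X in X <-> _]pair_familyE; exact: (model_neq HM). Qed.

Lemma model_homomorphism :
  (forall l x y, st_form (M := M) l x y -> b x y = l) ->
  homomorphism (id : M -> N).
Proof.
move=> bM; apply: homomorphism_of_atomic => [s a|r a]; first exact: model_fun.
case: r a => [|l] a; first by move/model_rel_neq.
by rewrite [a in X in X -> _]pair_familyE => /bM.
Qed.

Lemma model_immersion : immersion (id : M -> N) -> M = N.
Proof.
move=> iM; apply: fo_structure_eq => r a; first exact: model_fun.
exact: (immersion_rel _ iM).
Qed.

End Interpretation.
End ModelForm.

Lemma model_maps_to_bilin (K : fieldType) c (M : fo_structure (lk_sig K)) :
  model (bilin_theory K c) M ->
  exists2 N : bilin_space K, in_class c N &
    exists f : M -> bilin_structure N, homomorphism f.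
Proof.
move=> HM; have [b [bc bM]] := model_form HM.
by exists (BilinSpace _ b) => //; exists id; exact: model_homomorphism.
Qed.

(** The identity is an immersion, so it also reflects the form relations: the
    partial form was already total. *)
Lemma ec_model_bilin (K : fieldType) c (M : fo_structure (lk_sig K)) :
  ec_model (bilin_theory K c) M ->
  exists2 N : bilin_space K, in_class c N & M = bilin_structure N.
Proof.
move=> [HM ec]; have [b [bc bM]] := model_form HM.
exists (BilinSpace _ b) => //; apply: model_immersion.
apply: ec; first exact: bilin_structure_model.
exact: model_homomorphism.
Qed.

(** * Isometric embeddings *)

Lemma in_class_pullback (K : fieldType) c (N : bilin_space K) (U : lmodType K)
    (b : {bilinear U -> U -> K | *%R & *%R}) (g : U -> N) :
  (forall x y, bs_form N (g x) (g y) = b x y) ->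
  in_class c N -> in_class c (BilinSpace U b).
Proof. by case: c => //= gb Nc => [x y|x]; rewrite -!gb. Qed.

Section Pullback.
Variables (K : fieldType) (U : lmodType K) (N : bilin_space K).
Variable g : {linear U -> N}.

Definition pullback (x y : U) : K := bs_form N (g x) (g y).

Lemma pullback_scalarl y : scalar (pullback^~ y).
Proof. by move=> k x x'; rewrite /pullback linearP linearPl. Qed.

Lemma pullback_scalarr x : scalar (pullback x).
Proof. by move=> k y y'; rewrite /pullback linearP linearPr. Qed.

Definition pullback_form := mk_form pullback_scalarl pullback_scalarr.

End Pullback.

Lemma linear_commutes (K : fieldType) (U V : bilin_space K)
    (f : {linear U -> V}) :
  commutes_with_functions (f : bilin_structure U -> bilin_structure V).
Proof.
by case=> [|||l] a /=; rewrite ?linear0 ?linearD ?linearN ?linearZ.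
Qed.

Lemma eval_linear_map (K : fieldType) (U V : bilin_space K)
    (f : {linear U -> V}) n (a : 'I_n -> U) (t : term (lk_sig K) n) :
  eval (M := bilin_structure V) (f \o a) t =
  f (eval (M := bilin_structure U) a t).
Proof. exact/(@eval_comp _ (bilin_structure U))/linear_commutes. Qed.

Lemma mono_homomorphism (K : fieldType) (U V : bilin_space K)
    (f : {linear U -> V}) :
  bilin_mono (bs_form U) (bs_form V) f ->
  homomorphism (f : bilin_structure U -> bilin_structure V).
Proof.
move=> [f_inj fb]; apply: homomorphism_of_atomic; first exact: linear_commutes.
by case=> [|l] a /= => [a01 /f_inj|<-//].
Qed.

Lemma homomorphism_mono (K : fieldType) (U V : bilin_space K) (f : U -> V) :
  homomorphism (f : bilin_structure U -> bilin_structure V) ->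
  exists2 g : {linear U -> V}, bilin_mono (bs_form U) (bs_form V) g & g =1 f.
Proof.
move=> fH; have fF := homomorphism_fun fH.
have relH r a := homomorphism_rel (r := r) (a := a) fH.
have fL : linear f.
  move=> k x y; have := fF LkAdd (pair_family (k *: x) y).
  by have := fF (LkScale k) (fun=> x) => /= <-.
exists (mk_linear fL) => //; split=> [x y fxy|x y].
  apply: contrapT => xy.
  exact: (relH LkNeq (pair_family x y) xy fxy).
exact: (relH (LkForm (bs_form U x y)) (pair_family x y) erefl).
Qed.

(** * Finite injectivity and existential closedness *)

(** Finite injectivity for a pair [A -> B] that is not a literal inclusion of
    subspaces. *)
Lemma finitely_injective_along (K : fieldType) c (W : bilin_space K)
    (A B : vectType K) (b : {bilinear B -> B -> K | *%R & *%R})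
    (j : {linear A -> B}) (f : {linear A -> W}) :
  finitely_injective c W -> in_class c (BilinSpace B b) -> injective j ->
  bilin_mono (fun x y => b (j x) (j y)) (bs_form W) f ->
  exists2 g : {linear B -> W}, bilin_mono b (bs_form W) g &
    forall x, g (j x) = f x.
Proof.
move=> Winj bc j_inj [f_inj fb].
pose J := linfun j.
have kerJ : lker J == 0%VS.
  by apply/lker0P => x y; rewrite !lfunE => /j_inj.
have JK : cancel j (J^-1)%VF.
  by move=> x; have := lker0_lfunK kerJ x; rewrite lfunE.
pose A' := limg J.
have KJ (x : subvs_of A') : j ((J^-1)%VF (vsval x)) = vsval x.
  by have := limg_lfunVK (subvsP x); rewrite lfunE.
have [|g [g_mono gf]] :=
    Winj B b bc A' (f \o (J^-1)%VF \o @vsval _ _ A').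
  split=> [x y /= /f_inj xy|x y /=]; last by rewrite fb !KJ.
  by apply: val_inj; rewrite /= -[LHS]KJ xy KJ.
exists g => // x.
have xA : j x \in A' by rewrite -[j x]lfunE memv_img ?memvf.
by have := gf (Subvs xA); rewrite /= JK.
Qed.

(** The enlarged space is [B] itself when [x] is already in the image, and
    [B * K^o] otherwise. *)
Lemma adjoin (K : fieldType) (N : lmodType K) (B : vectType K)
    (g : {linear B -> N}) (x : N) :
  injective g ->
  exists (B' : vectType K) (j : {linear B -> B'}) (g' : {linear B' -> N}),
    [/\ injective g', forall y, g' (j y) = g y & exists y, g' y = x].
Proof.
move=> g_inj; have [[y gy]|nox] := pselect (exists y, g y = x).
  by exists B, idfun, g; split=> //; exists y.
pose g' (p : B * K^o) := g p.1 + (p.2 : K) *: x.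
have g'L : linear g'.
  move=> k p q; rewrite /g' /= linearP scalerDl scalerDr addrACA.
  by rewrite -[k *: p.2]/(k * p.2) scalerA.
have jL : linear (fun y : B => (y, 0 : K^o)).
  by move=> k y y'; congr (_, _); rewrite /= scaler0 addr0.
have g'0 p : g' p = 0 -> p = 0.
  case: p => y k; rewrite /g' /=; have [->|k0] := eqVneq (k : K) 0.
    by rewrite scale0r addr0 -(linear0 g) => /g_inj ->.
  move=> /eqP; rewrite addr_eq0 => /eqP gy; case: nox; exists (- k^-1 *: y).
  by rewrite linearZ /= gy scaleNr scalerN opprK scalerA mulVf // scale1r.
exists (B * K^o)%type, (mk_linear jL), (mk_linear g'L); split.
- by apply: raddf_inj => p; exact: g'0.
- by move=> y; rewrite -[LHS]/(g y + (0 : K) *: x) scale0r addr0.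
- by exists (0, 1); rewrite -[LHS]/(g 0 + (1 : K) *: x) linear0 add0r scale1r.
Qed.

Lemma finite_family_spans (K : fieldType) (W : lmodType K) n (a : 'I_n -> W) :
  exists (B : vectType K) (h : {linear B -> W}) (d : 'I_n -> B),
    injective h /\ a = h \o d.
Proof.
elim: n a => [|n IH] a.
  exists 'rV[K]_0, \0, (fun=> 0); split; last by apply/funext => -[].
  by move=> x y _; rewrite (thinmx0 x) (thinmx0 y).
have [B [h [d [h_inj ad]]]] := IH (fun i => a (lift ord0 i)).
have [B' [j [h' [h'_inj h'j [y hy]]]]] := adjoin (a ord0) h_inj.
exists B', h', (fun i => if unlift ord0 i is Some k then j (d k) else y).
split=> //; apply/funext => i /=; case: unliftP => [k|] ->; last by rewrite hy.
by rewrite h'j; exact: (congr1 (@^~ k) ad).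
Qed.

(** The two families [g \o d] and [h \o d] have the same linear relations and
    the same products; the existential quantifier is met by adjoining the
    witness to [B] and extending [h] by finite injectivity. *)
Lemma back_and_forth (K : fieldType) c (N W : bilin_space K) n
    (p : formula (lk_sig K) n) (B : vectType K)
    (b : {bilinear B -> B -> K | *%R & *%R})
    (g : {linear B -> N}) (h : {linear B -> W}) (d : 'I_n -> B) :
  in_class c N -> finitely_injective c W ->
  bilin_mono b (bs_form N) g -> bilin_mono b (bs_form W) h ->
  sat (M := bilin_structure N) p (g \o d) ->
  sat (M := bilin_structure W) p (h \o d).
Proof.
move=> Nc Winj; elim: p B b g h d => {n} //=.
- move=> n t u B b g h d [g_inj _] _.
  have gE := @eval_linear_map K (BilinSpace B b) N g n d.
  have hE := @eval_linear_map K (BilinSpace B b) W h n d.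
  by rewrite !gE !hE => /g_inj ->.
- move=> n r ts B b g h d [g_inj gb] [h_inj hb].
  have gE := @eval_linear_map K (BilinSpace B b) N g n d.
  have hE := @eval_linear_map K (BilinSpace B b) W h n d.
  case: r ts => [|l] ts /=; rewrite !gE !hE.
    by move=> neq /h_inj eq; apply: neq; rewrite eq.
  by rewrite gb hb.
- move=> n p IHp q IHq B b g h d gm hm [/(IHp _ _ _ _ _ gm hm) ?].
  by move=> /(IHq _ _ _ _ _ gm hm).
- by move=> n p IHp q IHq B b g h d gm hm [/(IHp _ _ _ _ _ gm hm)|
    /(IHq _ _ _ _ _ gm hm)]; [left|right].
move=> n p IH B b g h d [g_inj gb] [h_inj hb] [x px].
have [B' [j [g' [g'_inj g'j [y g'y]]]]] := adjoin x g_inj.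
have g'c : in_class c (BilinSpace B' (pullback_form g')).
  exact: (in_class_pullback (g := g')).
have [||h' h'm h'j] :=
    @finitely_injective_along _ c W B B' (pullback_form g') j h Winj g'c.
- by move=> u v juv; apply: g_inj; rewrite -!g'j juv.
- split=> // u v; rewrite hb -gb -!g'j; exact: erefl.
pose d' i := if unlift ord0 i is Some k then j (d k) else y.
have dN : @extend _ (bilin_structure N) n x (g \o d) = g' \o d'.
  by apply/funext => i; rewrite /extend /d' /=; case: (unlift ord0 i).
have dW : @extend _ (bilin_structure W) n (h' y) (h \o d) = h' \o d'.
  by apply/funext => i; rewrite /extend /d' /=; case: (unlift ord0 i).
exists (h' y); rewrite dW; apply: (IH _ (pullback_form g') g') => //.
by rewrite -dN.
Qed.

Lemma mono_immersion (K : fieldType) c (W N : bilin_space K)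
    (f : {linear W -> N}) :
  finitely_injective c W -> in_class c N ->
  bilin_mono (bs_form W) (bs_form N) f ->
  immersion (f : bilin_structure W -> bilin_structure N).
Proof.
move=> Winj Nc fm; split; first exact: mono_homomorphism.
move=> n p a pa; have [B [h [d [h_inj ad]]]] := finite_family_spans a.
move: pa; rewrite ad; case: (fm) => f_inj fb.
apply: (@back_and_forth _ c N W n p B (pullback_form h) (f \o h) h) => //.
by split=> [x y /= /f_inj /h_inj//|x y /=]; rewrite fb.
Qed.

Lemma finitely_injective_ec (K : fieldType) c (W : bilin_space K) :
  in_class c W -> finitely_injective c W ->
  ec_model (bilin_theory K c) (bilin_structure W).
Proof.
move=> Wc Winj; split=> [|N f NT fH]; first exact: bilin_structure_model.
have [N' N'c [h hH]] := model_maps_to_bilin NT.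
have fhH := homomorphism_comp fH hH.
apply: (immersion_of_comp fH hH).
have [g gm gE] := homomorphism_mono fhH.
have -> : h \o f = g :> (_ -> _) by apply/funext => x; rewrite gE.
exact: (mono_immersion Winj N'c).
Qed.

(** * Hyperbolic extensions *)

(** The second summand stands for the dual of [B], paired with [B] by
    coordinates; the sign makes the pairing of the two summands symmetric or
    alternating. *)
Section Hyperbolic.
Variables (K : fieldType) (c : bilin_class) (B : vectType K).
Variable b : {bilinear B -> B -> K | *%R & *%R}.
Let n := dim B.

Definition dot (u v : 'rV[K]_n) : K := (u *m v^T) 0 0.

Lemma dot_scalarl v : scalar (dot^~ v).
Proof.
move=> k u u'; rewrite /dot mulmxDl -scalemxAl.
by rewrite [LHS]mxE [X in X + _]mxE.
Qed.

Lemma dotC u v : dot u v = dot v u.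
Proof. by rewrite /dot -[u *m _]trmxK trmx_mul trmxK mxE. Qed.

Lemma dot_scalarr u : scalar (dot u).
Proof. by move=> k v v'; rewrite dotC dot_scalarl 2![dot _ u]dotC. Qed.

Lemma dot_nondegenerate u : (forall v, dot u v = 0) -> u = 0.
Proof.
move=> u0; apply/rowP => i; rewrite mxE -(u0 (delta_mx 0 i)).
by rewrite /dot trmx_delta -colE mxE.
Qed.

Definition class_sign : K := if c is AlternatingForms then - 1 else 1.

Definition hyperbolic (p q : B * 'rV[K]_n) : K :=
  b p.1 q.1 + dot p.2 (v2r q.1) + class_sign * dot (v2r p.1) q.2.

Lemma hyperbolic_scalarl q : scalar (hyperbolic^~ q).
Proof.
move=> k p p'; rewrite /hyperbolic /= linearPl linearP !dot_scalarl /=.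
by ring.
Qed.

Lemma hyperbolic_scalarr p : scalar (hyperbolic p).
Proof.
move=> k q q'; rewrite /hyperbolic /= linearPr linearP !dot_scalarr /=.
by ring.
Qed.

Definition hyperbolic_form := mk_form hyperbolic_scalarl hyperbolic_scalarr.

Lemma hyperbolic_class :
  in_class c (BilinSpace B b) -> in_class c (BilinSpace _ hyperbolic_form).
Proof.
(* the form depends on [c], so the case analysis is on a copy of it *)
suff class_eq d : d = c -> in_class d (BilinSpace B b) ->
    in_class d (BilinSpace _ hyperbolic_form) by exact: class_eq.
case: d => //= cE bc => [p q|p]; rewrite /mk_form /hyperbolic /class_sign -cE.
  rewrite bc !mul1r -!addrA; congr (_ + _).
  by rewrite [RHS]addrC [dot p.2 _]dotC [dot _ q.2]dotC.
by rewrite bc add0r mulN1r dotC subrr.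
Qed.

(** Testing against [(0, v)] kills the first component, and then testing
    against [(y, 0)] kills the second. *)
Lemma hyperbolic_nondegenerate :
  nondegenerate_space (BilinSpace _ hyperbolic_form).
Proof.
have sign0 : class_sign != 0.
  by rewrite /class_sign; case: (c); rewrite ?oppr_eq0 oner_eq0.
have v2r0 x : v2r x = 0 -> x = 0 :> B by rewrite -(linear0 v2r) => /v2r_inj.
have dot0l v : dot 0 v = 0 by rewrite /dot mul0mx mxE.
have dot0r v : dot v 0 = 0 by rewrite dotC dot0l.
split=> -[x u] xu0.
  have x0 : x = 0.
    apply/v2r0/dot_nondegenerate => v; apply/(mulfI sign0); rewrite mulr0.
    have := xu0 (0, v); rewrite /= /mk_form /hyperbolic /=.
    by rewrite linear0r linear0 dot0r addr0 add0r.
  rewrite x0 in xu0 *; congr (_, _); apply: dot_nondegenerate => v.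
  have := xu0 (@r2v _ B v, 0); rewrite /= /mk_form /hyperbolic /=.
  by rewrite linear0l dot0r mulr0 addr0 add0r r2vK.
have x0 : x = 0.
  apply/v2r0/dot_nondegenerate => v; rewrite dotC.
  have := xu0 (0, v); rewrite /= /mk_form /hyperbolic /=.
  by rewrite linear0l linear0 dot0l mulr0 addr0 add0r.
rewrite x0 in xu0 *; congr (_, _); apply: dot_nondegenerate => v.
apply/(mulfI sign0); rewrite mulr0 dotC.
have := xu0 (@r2v _ B v, 0); rewrite /= /mk_form /hyperbolic /=.
by rewrite linear0r linear0 dot0l addr0 add0r r2vK.
Qed.

Lemma hyperbolic_incl_linear : linear (fun x : B => (x, 0 : 'rV[K]_n)).
Proof. by move=> k x y; congr (_, _); rewrite /= scaler0 addr0. Qed.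

Definition hyperbolic_incl := mk_linear hyperbolic_incl_linear.

Lemma hyperbolic_incl_mono :
  bilin_mono b hyperbolic_form hyperbolic_incl.
Proof.
split=> [x y [] //|x y].
rewrite /hyperbolic_incl /hyperbolic_form /mk_form /hyperbolic /= /dot.
by rewrite mul0mx trmx0 mulmx0 mxE mulr0 !addr0.
Qed.

End Hyperbolic.

(** * Properties of finitely injective spaces *)

Section FinitelyInjective.
Variables (K : fieldType) (c : bilin_class) (W : bilin_space K).
Hypothesis Wc : in_class c W.
Hypothesis Winj : finitely_injective c W.

Lemma finitely_injective_infinite : infinite_dimensional W.
Proof.
move=> n [v v_lin v_bij].
pose U := 'rV[K]_n.+1.
have z_lin (x : U) : scalar (fun _ : U => 0 : K).
  by move=> k y y'; rewrite mulr0 addr0.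
pose b := mk_form z_lin z_lin.
have bc : in_class c (BilinSpace U b) by case: (c).
have [||g [g_inj _] _] :=
    @finitely_injective_along K c W 'rV[K]_0 U b \0 \0 Winj bc.
- by move=> x y _; rewrite (thinmx0 x) (thinmx0 y).
- split=> [x y _|x y /=]; first by rewrite (thinmx0 x) (thinmx0 y).
  by rewrite linear0l.
pose f := lin1_mx (mk_linear v_lin \o g).
have /eqP : kermx f = 0.
  apply/row_matrixP => i; rewrite row0; apply: g_inj; apply: (bij_inj v_bij).
  rewrite linear0 -[LHS]/((mk_linear v_lin \o g) _) -mul_rV_lin1.
  rewrite -row_mul mulmx_ker row0.
  by rewrite -[RHS]/(mk_linear v_lin _) linear0.
rewrite kermx_eq0 -row_leq_rank => /leq_trans/(_ (rank_leq_col _)).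
by rewrite ltnn.
Qed.

(** The line of [x] is modelled by [K^o] with the form [s * t * [x, x]].  Its
    hyperbolic extension is non-degenerate and embeds in [W] with [1] going to
    [x], so some image of a vector pairs nontrivially with [x]. *)
Lemma finitely_injective_dual (x : W) : x != 0 ->
  (exists y, bs_form W x y != 0) /\ (exists y, bs_form W y x != 0).
Proof.
move=> x0.
have m_linl (t : K^o) : scalar (fun s : K^o => s * t * bs_form W x x : K).
  by move=> k s s'; rewrite -[k *: s]/(k * s); ring.
have m_linr (s : K^o) : scalar (fun t : K^o => s * t * bs_form W x x : K).
  by move=> k t t'; rewrite -[k *: t]/(k * t); ring.
pose b := mk_form m_linl m_linr.
have f_lin : linear (fun s : K^o => (s : K) *: x).
  by move=> k s s'; rewrite scalerDl -scalerA.
have f_form s t : bs_form W ((s : K) *: x) ((t : K) *: x) = b s t.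
  by rewrite linearZl_LR linearZr_LR /b /mk_form /= mulrA.
have bc : in_class c (BilinSpace K^o b).
  exact: (in_class_pullback (g := fun s : K^o => (s : K) *: x)).
have [j_inj jb] := hyperbolic_incl_mono c b.
have [|g [g_inj gb] gj] := finitely_injective_along Winj
    (hyperbolic_class bc) j_inj (f := mk_linear f_lin).
  split=> [s t /eqP|s t]; last exact: etrans (f_form s t) (esym (jb s t)).
  rewrite -subr_eq0 -[X in X == 0]scalerBl scaler_eq0 (negPf x0) orbF.
  by rewrite subr_eq0 => /eqP.
pose e := hyperbolic_incl (1 : K^o).
have gx : g e = x by rewrite gj; exact: scale1r.
have one_neq : e <> 0 by case=> /eqP; rewrite oner_eq0.
have [ndl ndr] := hyperbolic_nondegenerate c b.
split; apply: contrapT => /forallNP noy; apply: one_neq.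
  by apply: ndl => p; apply/eqP/negP => /negP; rewrite /= -gb gx; exact: noy.
by apply: ndr => p; apply/eqP/negP => /negP; rewrite /= -gb gx; exact: noy.
Qed.

Lemma finitely_injective_nondegenerate : nondegenerate_space W.
Proof.
split=> x xy0; apply/eqP; case: eqVneq => // /finitely_injective_dual.
  by move=> [[y]]; rewrite xy0 eqxx.
by move=> [_ [y]]; rewrite xy0 eqxx.
Qed.

End FinitelyInjective.

(** * Amalgamation *)

(** With [r] a retraction of [f], the amalgam is the orthogonal sum of [W],
    carrying its form minus the pullback of the form of [B] along [i \o r], and
    of [B].  The map [w |-> (w, i (r w))] restores what was subtracted, while
    [x |-> (f (s x), x)], with [s] a retraction of [i], only meets the first
    summand in the image of [f], where the difference of the forms vanishes. *)
Lemma amalgamation (K : fieldType) c (W B : bilin_space K) (A : lmodType K)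
    (f : {linear A -> W}) (i : {linear A -> B}) :
  in_class c W -> in_class c B -> injective f -> injective i ->
  (forall x y, bs_form W (f x) (f y) = bs_form B (i x) (i y)) ->
  exists2 N : bilin_space K, in_class c N &
    exists (h : {linear W -> N}) (g : {linear B -> N}),
    [/\ bilin_mono (bs_form W) (bs_form N) h,
        bilin_mono (bs_form B) (bs_form N) g & forall x, h (f x) = g (i x)].
Proof.
move=> Wc Bc f_inj i_inj fi.
have [r fK] := linear_retraction f_inj.
have [s iK] := linear_retraction i_inj.
pose n (p q : W * B) := bs_form W p.1 q.1 -
  bs_form B (i (r p.1)) (i (r q.1)) + bs_form B p.2 q.2.
have nl q : scalar (n^~ q).
  by move=> k p p'; rewrite /n /= !linearP !linearPl /=; ring.
have nr p : scalar (n p).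
  by move=> k q q'; rewrite /n /= !linearP /=; ring.
have h_lin : linear (fun w => (w, i (r w))).
  by move=> k w w'; rewrite !linearP.
have g_lin : linear (fun x => (f (s x), x)).
  by move=> k x x'; rewrite !linearP.
exists (BilinSpace _ (mk_form nl nr)).
  case: (c) Wc Bc => //= Wc Bc => [p q|p]; rewrite /mk_form /n.
    by rewrite Wc [bs_form B p.2 _]Bc [bs_form B (i _) _]Bc.
  by rewrite Wc !Bc subrr addr0.
exists (mk_linear h_lin), (mk_linear g_lin); split.
- split=> [w w' []//|w w']; by rewrite /= /mk_form /mk_linear /n /= subrK.
- split=> [x x' [] //|x x'].
  by rewrite -[LHS]/(n (f (s x), x) (f (s x'), x')) /n /= !fK fi subrr add0r.
- move=> x; rewrite -[LHS]/(f x, i (r (f x))) fK.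
  by rewrite -[RHS]/(f (s (i x)), i x) iK.
Qed.

(** * Existentially closed spaces are finitely injective *)

Section Coordinates.
Variables (K : fieldType) (B : vectType K).
Local Notation n := (dim B).

Definition std_basis (i : 'I_n) : B := r2v (delta_mx 0 i).

Lemma std_basisE x : x = \sum_i v2r x 0 i *: std_basis i.
Proof.
rewrite -{1}[x]v2rK {1}[v2r x]row_sum_delta linear_sum.
by apply: eq_bigr => i _; rewrite linearZ.
Qed.

Lemma eq_on_basis (V : lmodType K) (f g : {linear B -> V}) :
  (forall i, f (std_basis i) = g (std_basis i)) -> f =1 g.
Proof.
move=> fg x; rewrite [x]std_basisE !linear_sum.
by apply: eq_bigr => i _; rewrite !linearZ fg.
Qed.

Lemma form_on_basis (V : bilin_space K)
    (b : {bilinear B -> B -> K | *%R & *%R}) (f : {linear B -> V}) :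
  (forall i j, bs_form V (f (std_basis i)) (f (std_basis j)) =
     b (std_basis i) (std_basis j)) ->
  forall x y, bs_form V (f x) (f y) = b x y.
Proof.
move=> fb x y.
have fb_y i : bs_form V (f (std_basis i)) (f y) = b (std_basis i) y.
  rewrite [y]std_basisE !linear_sum; apply: eq_bigr => j _.
  by rewrite !linearZ /= fb.
rewrite [x]std_basisE linear_sum !linear_sumlz; apply: eq_bigr => i _.
by rewrite linearZ /= !linearZl_LR fb_y.
Qed.

Definition lin_comb (V : lmodType K) (y : 'I_n -> V) (x : B) : V :=
  \sum_i v2r x 0 i *: y i.

Lemma lin_comb_linear (V : lmodType K) (y : 'I_n -> V) : linear (lin_comb y).
Proof.
move=> k x x'; rewrite /lin_comb scaler_sumr -big_split.
by apply: eq_bigr => i _; rewrite /= linearP !mxE scalerDl scalerA.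
Qed.

Definition lin_comb_map (V : lmodType K) (y : 'I_n -> V) : {linear B -> V} :=
  mk_linear (lin_comb_linear y).

Lemma lin_comb_basis (V : lmodType K) (y : 'I_n -> V) i :
  lin_comb_map y (std_basis i) = y i.
Proof.
rewrite -[LHS]/(lin_comb y _) /lin_comb (bigD1 i) //=.
rewrite big1 => [|j ji]; rewrite r2vK mxE ?eqxx /=.
  by rewrite scale1r addr0.
by rewrite (negPf ji) scale0r.
Qed.

End Coordinates.

Definition t_sum (K : fieldType) n (I : Type) (s : seq I)
    (F : I -> term (lk_sig K) n) : term (lk_sig K) n :=
  foldr (fun i t => t_add (F i) t) t_zero s.

Lemma eval_sum (K : fieldType) (W : bilin_space K) n (a : 'I_n -> W)
    (I : Type) (s : seq I) (F : I -> term (lk_sig K) n) :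
  eval (M := bilin_structure W) a (t_sum s F) =
  \sum_(i <- s) eval (M := bilin_structure W) a (F i).
Proof.
elim: s => [|i s IH]; first by rewrite big_nil.
by rewrite big_cons -IH; exact: (@eval_add K (bilin_structure W)).
Qed.

(** The formula says, of vectors [y_j] standing for the basis of [B], that they
    have the prescribed products and that the parameters, the images of the
    basis of [A], are the prescribed combinations of the [y_j]. *)
Lemma immersion_pullback (K : fieldType) (W N : bilin_space K)
    (A B : vectType K) (b : {bilinear B -> B -> K | *%R & *%R})
    (i : {linear A -> B}) (f : {linear A -> W})
    (h : {linear W -> N}) (g : {linear B -> N}) :
  immersion (h : bilin_structure W -> bilin_structure N) ->
  (forall x y, bs_form N (g x) (g y) = b x y) ->
  (forall x, h (f x) = g (i x)) ->
  exists2 g' : {linear B -> W},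
    forall x y, bs_form W (g' x) (g' y) = b x y & forall x, g' (i x) = f x.
Proof.
move=> [_ h_refl] gb hf.
pose eA (k : 'I_(dim A)) := @std_basis K A k.
pose eB (j : 'I_(dim B)) := @std_basis K B j.
pose v (k : 'I_(dim B + dim A)) : term (lk_sig K) (dim B + dim A) := Var _ k.
pose pA (k : 'I_(dim A)) := Eq (v (rshift (dim B) k))
  (t_sum (enum 'I_(dim B)) (fun j =>
     t_scale (v2r (i (eA k)) 0 j) (v (lshift (dim A) j)))).
pose pB (q : 'I_(dim B) * 'I_(dim B)) := t_form (b (eB q.1) (eB q.2))
  (v (lshift (dim A) q.1)) (v (lshift (dim A) q.2)).
pose p := And (conjunction [seq pA k | k <- enum 'I_(dim A)])
  (conjunction [seq pB q | q <- enum {: 'I_(dim B) * 'I_(dim B)}]).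
have pE (U : bilin_space K) (y : 'I_(dim B + dim A) -> U) :
    sat (M := bilin_structure U) p y <->
    (forall k, y (rshift (dim B) k) =
       lin_comb (y \o lshift (dim A)) (i (eA k))) /\
    (forall j k, bs_form U (y (lshift (dim A) j)) (y (lshift (dim A) k)) =
       b (eB j) (eB k)).
  have pAE k : sat (M := bilin_structure U) (pA k) y <->
      y (rshift (dim B) k) = lin_comb (y \o lshift (dim A)) (i (eA k)).
    rewrite -[sat _ _]/(y (rshift (dim B) k) =
      eval (M := bilin_structure U) y _).
    by rewrite eval_sum big_enum.
  split=> [[pAy pBy]|[yA yB]].
    split=> [k|j k].
      apply/pAE.
      apply: ((sat_conjunction (M := bilin_structure U) _ pA y).1 pAy).
      by rewrite mem_enum.
    apply: ((sat_conjunction (M := bilin_structure U) _ pB y).1 pBy (j, k)).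
    by rewrite mem_enum.
  split.
    apply/(sat_conjunction (M := bilin_structure U) _ pA y) => k _.
    exact/pAE.
  apply/(sat_conjunction (M := bilin_structure U) _ pB y) => q _.
  exact: yB.
pose a (k : 'I_(dim A)) := f (eA k).
(* in [N], the images under [g] of the basis of [B] are witnesses *)
have /h_refl/sat_exs[y [ya /pE[yA yB]]] :
    sat (M := bilin_structure N) (exs p) (h \o a).
  apply/sat_exs.
  exists (fun l => match split l with
    inl j => g (eB j) | inr k => h (a k) end).
  split=> [k|]; first by rewrite -[rshift _ _]/(unsplit (inr k)) unsplitK.
  have splitl j : split (lshift (dim A) j) = inl j :=
    @unsplitK (dim B) (dim A) (inl j).
  have splitr j : split (rshift (dim B) j) = inr j :=
    @unsplitK (dim B) (dim A) (inr j).
  apply/pE; split=> [k|j k]; rewrite ?splitl ?splitr; last exact: gb.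
  rewrite hf; apply: (@eq_on_basis K B N g (lin_comb_map _)) => j.
  by rewrite lin_comb_basis /= splitl.
exists (lin_comb_map (y \o lshift (dim A))).
  apply: form_on_basis => j k.
  by rewrite !lin_comb_basis /= yB.
apply: (@eq_on_basis K A W (lin_comb_map _ \o i) f) => k.
by rewrite -[LHS]/(lin_comb _ _) -[RHS](ya k) yA.
Qed.

(** Passing to the hyperbolic extension of [B] makes the isometry obtained from
    the immersion injective, since its kernel is orthogonal to everything. *)
Lemma ec_finitely_injective (K : fieldType) c (W : bilin_space K) :
  in_class c W -> ec_model (bilin_theory K c) (bilin_structure W) ->
  finitely_injective c W.
Proof.
move=> Wc [_ ec] B b bc A f [f_inj fb].
have [j_inj jb] := hyperbolic_incl_mono c b.
pose B' := BilinSpace _ (hyperbolic_form c b).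
pose i : {linear subvs_of A -> B'} := @hyperbolic_incl K B \o @vsval _ _ A.
have i_inj : injective i by move=> x y /j_inj/val_inj.
have [|N Nc [h [g [h_mono [_ gb] hf]]]] :=
    amalgamation (B := B') (i := i) Wc (hyperbolic_class bc) f_inj i_inj.
  by move=> x y; rewrite fb; exact/esym/jb.
have h_imm : immersion (h : bilin_structure W -> bilin_structure N).
  by apply: ec; [exact: bilin_structure_model|exact: mono_homomorphism].
have [g' g'b g'f] := immersion_pullback h_imm gb hf.
exists (g' \o @hyperbolic_incl K B); split; last exact: g'f.
split=> [|x y]; last exact: etrans (g'b _ _) (jb x y).
apply: inj_comp j_inj; apply: raddf_inj => x gx.
apply: (hyperbolic_nondegenerate c b).1 => y.
by rewrite -[LHS]g'b gx linear0l.
Qed.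

Theorem theorem1p2 (K : fieldType) (c : bilin_class)
    (V : fo_structure (lk_sig K)) :
  [<-> ec_model (bilin_theory K c) V;
       exists W : bilin_space K,
         V = bilin_structure W /\ in_class c W /\ finitely_injective c W;
       exists W : bilin_space K,
         V = bilin_structure W /\ in_class c W /\
         infinite_dimensional W /\ nondegenerate_space W /\
         finitely_injective c W].
Proof.
tfae.
- move=> Vec; have [W Wc VW] := ec_model_bilin Vec.
  exists W; split=> //; split=> //.
  by apply: ec_finitely_injective => //; rewrite -VW.
- move=> [W [VW [Wc Winj]]]; exists W; do 2![split=> //].
  split; first exact: finitely_injective_infinite Winj.
  by split=> //; exact: finitely_injective_nondegenerate Winj.
- move=> [W [-> [Wc [_ [_ Winj]]]]]; exact: finitely_injective_ec.
Qed.
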